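(* Let $F:\mathbb{R}^d\to\mathbb{R}^d$, let $x_*\in\mathbb{R}^d$ satisfy $F(x_* )=|x_*|$, and set $y_*=x_*^+$, $z_*=x_*^-$, so that $x_*=y_*-z_*$ and $F(y_*-z_* )-(y_*+z_* )=0$. Assume that $F$ is $C^1$ in a neighborhood of $x_*$. Then: (i) If $F-I$ is a $P_0$-map, then there exists a $C^1$ map $H$ with values in $\mathbb{R}^d$, defined in a neighborhood $U$ of $y_*$, with $H(y)=F(y-H(y))-y$ for all $y\in U$, such that $z_*=H(y_* )$ and $y_*$ is a solution of the nonlinear complementarity problem $$H(y)=F(y-H(y))-y,\qquad 0\le y\perp H(y)\ge 0.$$ (ii) If $-(F+I)$ is a $P_0$-map, then there exists a $C^1$ map $\widetilde H$ with values in $\mathbb{R}^d$, defined in a neighborhood $W$ of $z_*$, with $\widetilde H(z)=F(\widetilde H(z)-z)-z$ for all $z\in W$, such that $y_*=\widetilde H(z_* )$ and $z_*$ is a solution of the nonlinear complementarity problem $$\widetilde H(z)=F(\widetilde H(z)-z)-z,\qquad 0\le z\perp \widetilde H(z)\ge 0.$$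
   Context: For $x=(x^1,\dots,x^d)^T\in\mathbb{R}^d$, $|x|=(|x^1|,\dots,|x^d|)^T$, and $x^+=\max\{x,0\}$, $x^-=\max\{-x,0\}$ are taken coordinatewise. $I$ denotes the identity map of $\mathbb{R}^d$. A map $G:\mathbb{R}^d\to\mathbb{R}^d$ is a $P_0$-map if for all $x\ne y$ in $\mathbb{R}^d$, $\max_{1\le i\le d,\ x^i\ne y^i}(x^i-y^i)(G(x)^i-G(y)^i)\ge 0$. The notation $0\le y\perp z\ge 0$ means $y,z\in\mathbb{R}^d_+$ and $y^jz^j=0$ for every $j\in\{1,\dots,d\}$. *)

(* Defs.v *)
(* R^d is the space 'rV[R]_d of row vectors over a
   realType R, the carrier for which the library defines the Jacobian. *)
From HB Require Import structures.
From mathcomp Require Import all_boot all_order all_algebra.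
From mathcomp Require Import all_classical all_reals all_analysis.

Set Implicit Arguments.
Unset Strict Implicit.
Unset Printing Implicit Defensive.

Import Order.TTheory GRing.Theory Num.Theory.
Import numFieldNormedType.Exports.

Local Open Scope classical_set_scope.
Local Open Scope ring_scope.

Definition absv (R : realType) (d : nat) (x : 'rV[R]_d) : 'rV[R]_d :=
  map_mx (fun t => `|t|) x.

Definition posv (R : realType) (d : nat) (x : 'rV[R]_d) : 'rV[R]_d :=
  map_mx (fun t => Num.max t 0) x.

Definition negv (R : realType) (d : nat) (x : 'rV[R]_d) : 'rV[R]_d :=
  map_mx (fun t => Num.max (- t) 0) x.

(* The maximum is taken in \bar R only because a big maximum needs a unit;
   for x <> y the index set is nonempty, so the unit -oo plays no role. *)
Definition P0_map (R : realType) (d : nat) (G : 'rV[R]_d -> 'rV[R]_d) : Prop :=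
  forall x y : 'rV[R]_d, x <> y ->
    (0 <= \big[maxe/-oo]_(i < d | (x 0 i != y 0 i)%R)
            ((x 0 i - y 0 i) * (G x 0 i - G y 0 i))%R%:E)%E.

(* Meant for U open: the notion then depends only on the values of f on U,
   so a total f faithfully represents a C^1 map defined on U. *)
Definition C1_on (R : realType) (d : nat) (U : set 'rV[R]_d)
    (f : 'rV[R]_d -> 'rV[R]_d) : Prop :=
  forall x, U x -> differentiable f x /\ {for x, continuous (jacobian f)}.

(* 0 <= y _|_ z >= 0 *)
Definition complementary (R : realType) (d : nat) (y z : 'rV[R]_d) : Prop :=
  [/\ forall j, 0 <= y 0 j, forall j, 0 <= z 0 j &
      forall j, y 0 j * z 0 j = 0].

(* Main.v *)
(** With [x = y - z], the equation [z = F (y - z) - y] reads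
    [(F x + x) / 2 = y].  If [F - I] is a P_0-map then the Jacobian of
    [F + I = (F - I) + 2 I] is nonsingular, so [(F + I) / 2] has a local C^1
    inverse [g] at [ys], and [H y = y - g y].  Symmetrically,
    [y = F (y - z) - z] reads [(F x - x) / 2 = z], the inverse of
    [(F - I) / 2] exists because [- (F - I) = - (F + I) + 2 I], and
    [Ht z = z + g z]. *)
Require Import Defs.
From HB Require Import structures.
From mathcomp Require Import all_boot all_order all_algebra.
From mathcomp Require Import all_classical all_reals all_analysis.
From mathcomp Require Import ring lra.

Import Order.TTheory GRing.Theory Num.Theory.
Import numFieldNormedType.Exports.

Local Open Scope classical_set_scope.
Local Open Scope ring_scope.

Section inverse_function.
Set Implicit Arguments.
Unset Strict Implicit.
Context (R : realType).

(** * Estimates for matrix products in the max norm *)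

Lemma mx_norm_leP m n (M : 'M[R]_(m, n)) (c : R) : 0 <= c ->
  (`|M| <= c) <-> (forall i j, `|M i j| <= c).
Proof.
move=> c0; rewrite [`|M|]/Num.norm /= mx_normrE; split=> [Mc i j|Mc].
  by apply: le_trans Mc; exact: (le_bigmax _ (fun ij => `|M ij.1 ij.2|) (i, j)).
by apply: bigmax_le => // -[i j] _; exact: Mc.
Qed.

Lemma mx_entry_le_norm m n (M : 'M[R]_(m, n)) i j : `|M i j| <= `|M|.
Proof. exact: (mx_norm_leP M (normr_ge0 M)).1. Qed.

(** The norm is the largest absolute entry, and an entry of the product is a sum of [m] terms; hence
    the factor [m]. *)
Lemma norm_mulmx_le p m n (U : 'M[R]_(p, m)) (M : 'M[R]_(m, n)) :
  `|U *m M| <= m%:R * `|M| * `|U|.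
Proof.
apply/mx_norm_leP => [|i j]; first by rewrite !mulr_ge0.
rewrite mxE (le_trans (ler_norm_sum _ _ _))//.
have -> : m%:R * `|M| * `|U| = \sum_(k < m) `|M| * `|U|.
  by rewrite sumr_const card_ord -mulrA mulr_natl.
apply: ler_sum => k _; rewrite normrM mulrC.
by apply: ler_pM => //; exact: mx_entry_le_norm.
Qed.

Lemma mulmxr_bounded m n (M : 'M[R]_(m, n)) :
  exists2 K : R, 0 < K & forall v : 'rV[R]_m, `|v *m M| <= K * `|v|.
Proof.
(* The [+ 1] keeps the constant positive even for [M = 0], so that it can be divided by later. *)
exists (m%:R * `|M| + 1); first by rewrite ltr_wpDl// mulr_ge0.
by move=> v; apply: le_trans (norm_mulmx_le _ _) _; rewrite ler_wpM2r// lerDl.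
Qed.

Lemma mulmxr_continuous m n (M : 'M[R]_(m, n)) :
  continuous (fun v : 'rV[R]_m => v *m M).
Proof.
apply/(@linear_bounded_continuous _ _ _ (mulmxr M))/linear_boundedP.
near=> r => v /=; apply: le_trans (norm_mulmx_le _ _) _.
by rewrite ler_wpM2r.
Unshelve. all: by end_near. Qed.

(** * Jacobians and the mean value inequality *)

(** Uniqueness of the differential turns a first-order estimate into both differentiability and the
    value of the Jacobian. Jacobians are computed below through this criterion. *)
Lemma differentiable_jacobianP m n (f : 'rV[R]_m -> 'rV[R]_n) x M :
  (differentiable f x /\ jacobian f x = M) <->
  forall e : R, 0 < e ->
    \forall y \near x, `|f y - f x - (y - x) *m M| <= e * `|y - x|.
Proof.
have shiftE (L : 'rV[R]_m -> 'rV[R]_n) :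
    f \o shift x = cst (f x) + L +o_ 0 id <->
    forall e : R, 0 < e -> \forall y \near x,
      `|f y - f x - L (y - x)| <= e * `|y - x|.
  split=> [/eqaddoP H|H]; last apply/eqaddoP.
    move=> e e0; rewrite (near_shift 0 x).
    apply: filterS (H e e0) => h.
    by rewrite !fctE/= !subr0 addrK opprD addrA.
  move=> e e0; have := H e e0; rewrite (near_shift 0 x).
  apply: filterS => h.
  by rewrite !fctE/= !subr0 addrK opprD addrA.
split=> [[/diff_locallyP[_ /shiftE fx] <-] e e0|H].
  by apply: filterS (fx e e0) => y; rewrite mul_rV_lin1.
have fM := (shiftE (mulmxr M)).2 H.
have dM : 'd f x = mulmxr M :> (_ -> _).
  by apply: diff_unique fM; exact: mulmxr_continuous.
split.
  by apply/diff_locallyP; rewrite dM; split => //; exact: mulmxr_continuous.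
by apply/row_matrixP => i; rewrite !rowE mul_rV_lin1 dM.
Qed.

Lemma jacobian_scale_add_mx m n (f : 'rV[R]_m -> 'rV[R]_n) x (a : R)
    (N : 'M[R]_(m, n)) :
  differentiable f x ->
  let g := fun y => a *: f y + y *m N in
  differentiable g x /\ jacobian g x = a *: jacobian f x + N.
Proof.
move=> df; apply/differentiable_jacobianP => e e0.
(* Dividing by [|a| + 1] rather than [|a|] covers [a = 0]. *)
have a1 : 0 < `|a| + 1 by rewrite ltr_wpDl.
have := (differentiable_jacobianP _ _ _).1 (conj df erefl) (e / (`|a| + 1)).
rewrite divr_gt0// => /(_ isT); apply: filterS => y fy.
have -> : a *: f y + y *m N - (a *: f x + x *m N)
    - (y - x) *m (a *: jacobian f x + N)
    = a *: (f y - f x - (y - x) *m jacobian f x).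
  rewrite mulmxDr -scalemxAr (mulmxBl y x N).
  move: (y *m N) (x *m N) (f y) (f x) (_ *m jacobian f x) => *.
  by rewrite !scalerBr; apply/rowP => k; rewrite !mxE; ring.
rewrite normrZ; apply: le_trans (ler_wpM2l (normr_ge0 a) fy) _.
rewrite mulrA ler_wpM2r// mulrCA ger_pMr// ler_pdivrMr// mul1r.
by rewrite lerDl.
Qed.

(** The scalar mean value theorem is applied to each coordinate of [f z - z *m M] along the segment
    from [y] to [x]. The intermediate point depends on the coordinate, which is harmless for the max
    norm. *)
Lemma mean_value_jacobian m n (f : 'rV[R]_m -> 'rV[R]_n) a (r : R)
    (M : 'M[R]_(m, n)) (e : R) :
  0 <= e ->
  (forall z, ball a r z ->
    differentiable f z /\
    forall v : 'rV[R]_m, `|v *m (jacobian f z - M)| <= e * `|v|) ->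
  forall x y, ball a r x -> ball a r y ->
    `|f x - f y - (x - y) *m M| <= e * `|x - y|.
Proof.
move=> e0 fM x y ax ay; apply/mx_norm_leP => [|i j]; first exact: mulr_ge0.
rewrite {i}(ord1 i); pose v := x - y.
pose z (t : R) := y + t *: v.
have az (t : R) : t \in `[0, 1] -> ball a r (z t).
  rewrite in_itv/= => /andP[t0 t1]; move: ax ay; rewrite -!ball_normE/= => ax ay.
  have -> : a - z t = t *: (a - x) + (1 - t) *: (a - y).
    rewrite /z /v scalerBl scale1r !scalerBr addrC.
    rewrite [RHS]addrACA [RHS]addrC.
    by apply/rowP => k; rewrite !mxE; ring.
  apply: le_lt_trans (ler_normD _ _) _; rewrite !normrZ.
  rewrite (ger0_norm t0) ger0_norm ?subr_ge0//.
  (* Strictness is drawn from the term with weight [t], so [t = 0] is treated apart. *)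
  have [->|t0'] := eqVneq t 0; first by rewrite mul0r add0r subr0 mul1r.
  have -> : r = t * r + (1 - t) * r by rewrite mulrBl mul1r addrC subrK.
  apply: ltr_leD; first by rewrite ltr_pM2l// lt_def t0'.
  by rewrite ler_wpM2l ?subr_ge0// ltW.
pose h (t : R) : R := (f (z t) - z t *m M) 0 j.
have dh (t : R) : t \in `[0, 1] ->
    is_derive t 1 h ((v *m (jacobian f (z t) - M)) 0 j).
  move=> t01; have [dfz _] := fM _ (az t t01).
  have [dF JF] : differentiable (fun u => f u - u *m M) (z t) /\
      jacobian (fun u => f u - u *m M) (z t) = jacobian f (z t) - M.
    have -> : (fun u => f u - u *m M) = (fun u => 1 *: f u + u *m (- M)).
      by apply/funext => u; rewrite scale1r mulmxN.
    by have := jacobian_scale_add_mx 1 (- M) dfz; rewrite scale1r.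
  have dz : is_diff t z ( *:%R^~ v).
    have := is_diffD (is_diff_cst y t) (is_diff_scalel t v).
    by rewrite add0r.
  have dFz : differentiable ((fun u => f u - u *m M) \o z) t.
    exact: differentiable_comp.
  have cFz : derivable ((fun u => f u - u *m M) \o z) t 1.
    exact: diff_derivable.
  apply: DeriveDef; first exact: ((derivable_mxP _ _ _).1 cFz 0 j).
  have := derive_mx cFz; rewrite deriveE// diff_comp// diff_val/= scale1r.
  by rewrite -mul_rV_lin1 -/(jacobian _ _) JF => ->; rewrite mxE.
pose dh' (t : R) : R := (v *m (jacobian f (z t) - M)) 0 j.
have dh_oo (t : R) : t \in `]0, 1[ -> is_derive t 1 h (dh' t).
  by move=> t01; apply: dh; apply: subset_itv_oo_cc t01.
have ch : {within `[0, 1], continuous h}.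
  apply: derivable_within_continuous => t t01.
  by have [] := dh t t01.
have [t t01] := MVT_segment ler01 dh_oo ch.
rewrite subr0 mulr1 => hE.
have -> : (f x - f y - (x - y) *m M) 0 j = h 1 - h 0.
  rewrite /h /z scale1r scale0r addr0 /v (addrC y) subrK mulmxBl.
  by move: (x *m M) (y *m M) => *; rewrite !mxE; ring.
rewrite hE; have [_ /(_ v)] := fM (z t) (az t t01).
by apply: le_trans; exact: mx_entry_le_norm.
Qed.

(** * Matrix inversion near an invertible matrix *)

(** With [K = n |A^-1|], one has [|U| <= K |U A| <= K |U M| + K n |A - M| |U|], and the last term is
    at most [|U| / 2] for [M] close to [A]. Row vectors [U] then show that [M] has trivial kernel;
    [U = invmx M] bounds the inverse. *)
Lemma near_invmx_bound n (A : 'M[R]_n) : A \in unitmx ->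
  \forall M \near A, M \in unitmx /\ forall p (U : 'M[R]_(p, n)),
    `|U| <= 2 * (n%:R * `|invmx A|) * `|U *m M|.
Proof.
move=> uA; set K := n%:R * `|invmx A|.
have K0 : 0 <= K by rewrite mulr_ge0.
have c0 : 0 < 2 * (K * n%:R + 1) by rewrite mulr_gt0// ltr_wpDl// mulr_ge0.
have cV : 0 < (2 * (K * n%:R + 1))^-1 by rewrite invr_gt0.
have : \forall M \near A, `|A - M| <= (2 * (K * n%:R + 1))^-1.
  by have /cvgrPdist_le := @cvg_id _ (nbhs A); exact.
apply: filterS => M AM.
have KM : K * (n%:R * `|A - M|) <= 2^-1.
  rewrite mulrA; apply: le_trans (ler_wpM2l _ AM) _; first exact: mulr_ge0.
  rewrite ler_pdivrMr// mulrA mulVf// mul1r; nra.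
have bound p (U : 'M[R]_(p, n)) : `|U| <= 2 * K * `|U *m M|.
  have UA : `|U| <= K * `|U *m A|.
    by rewrite -{1}(mulmxK uA U) norm_mulmx_le.
  have : `|U *m A| <= `|U *m M| + n%:R * `|A - M| * `|U|.
    have -> : U *m A = U *m M + U *m (A - M) by rewrite mulmxBr addrC subrK.
    by apply: le_trans (ler_normD _ _) _; rewrite lerD2l norm_mulmx_le.
  move=> /(ler_wpM2l K0); have := ler_wpM2r (normr_ge0 U) KM.
  lra.
split; last exact: bound.
rewrite unitmxE unitfE; apply/det0P => -[v v0 vM].
by have := bound _ v; rewrite vM normr0 mulr0 normr_le0 (negPf v0).
Qed.

(** This rests on [A^-1 - M^-1 = M^-1 (M - A) A^-1], with [|M^-1|] bounded uniformly for [M] near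
    [A]; [C] below is the resulting Lipschitz constant at [A]. *)
Lemma invmx_continuous n (A : 'M[R]_n) :
  A \in unitmx -> {for A, continuous (@invmx R n)}.
Proof.
move=> uA; apply/(@cvgrPdist_le _ _ _ (nbhs A) (nbhs_filter A)) => e e0.
set K := n%:R * `|invmx A|.
have K0 : 0 <= K by rewrite mulr_ge0.
pose C : R := K * n%:R * (2 * K * `|1%:M : 'M[R]_n|).
have C0 : 0 <= C by rewrite !mulr_ge0.
have eC : 0 < e / (C + 1) by rewrite divr_gt0// ltr_wpDl.
near=> M.
have [uM /(_ _ (invmx M))] : M \in unitmx /\ forall p (U : 'M[R]_(p, n)),
    `|U| <= 2 * K * `|U *m M|.
  by near: M; exact: near_invmx_bound.
rewrite mulVmx// => M1.
have AM : `|A - M| <= e / (C + 1).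
  by near: M; have /cvgrPdist_le := @cvg_id _ (nbhs A); exact.
have -> : invmx A - invmx M = invmx M *m (M - A) *m invmx A.
  by rewrite mulmxBr mulVmx// mulmxBl mul1mx mulmxK.
apply: le_trans (norm_mulmx_le _ _) _; rewrite -/K.
have : `|invmx M *m (M - A)| <= n%:R * `|A - M| * `|invmx M|.
  by rewrite -(distrC M A); exact: norm_mulmx_le.
move=> /(ler_wpM2l K0) /le_trans; apply.
have : C * `|A - M| <= e.
  apply: le_trans (ler_wpM2l C0 AM) _.
  by rewrite mulrCA ger_pMr// ler_pdivrMr ?mul1r ?lerDl// ltr_wpDl.
apply: le_trans.
have -> : K * (n%:R * `|A - M| * `|invmx M|) =
    K * n%:R * `|invmx M| * `|A - M| by ring.
by rewrite ler_wpM2r// ler_wpM2l// mulr_ge0.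
Unshelve. all: by end_near. Qed.

(** Since [U] is open, the formula for the Jacobian holds near each point, so continuity carries
    over. *)
Lemma C1_on_scale_add_id d U (f : 'rV[R]_d -> 'rV[R]_d) (a b : R) :
  open U -> C1_on U f -> C1_on U (fun x => a *: f x + b *: x).
Proof.
move=> oU fU.
pose g (x : 'rV[R]_d) := a *: f x + x *m b%:M.
have -> : (fun x => a *: f x + b *: x) = g.
  by apply/funext => x; rewrite /g mul_mx_scalar.
have Jg y : U y -> jacobian g y = a *: jacobian f y + b%:M.
  by move=> /fU[dfy _]; have [] := jacobian_scale_add_mx a b%:M dfy.
move=> x Ux; split; first by have [] := jacobian_scale_add_mx a b%:M (fU x Ux).1.
suff : jacobian g z @[z --> x] --> jacobian g x by [].
have fx : (a *: jacobian f z + b%:M) @[z --> x] --> a *: jacobian f x + b%:M.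
  have c1 := @cvgZl_tmp _ _ _ _ (nbhs_filter x) a _ _ (fU x Ux).2.
  exact: (@cvgD _ _ _ _ (nbhs_filter x) _ _ _ _ c1 (cvg_cst _)).
rewrite Jg//; apply: cvg_trans fx; apply: (near_eq_cvg (FF := nbhs_filter x)).
by apply: filterS (open_nbhs_nbhs (conj oU Ux)) => y Uy; rewrite Jg.
Qed.

(** * The inverse function theorem *)

(* A minimizer [x] of [|(f x - w) B^-1|] over a closed ball is a zero, because
   the simplified Newton step [x - (f x - w) B^-1] stays in the ball and halves
   that quantity. *)
Lemma newton_solution d (f : 'rV[R]_d -> 'rV[R]_d) a (B : 'M[R]_d) (s : R) w :
  B \in unitmx -> 0 < s ->
  (forall x, `|a - x| <= s -> {for x, continuous f}) ->
  (forall x y, `|a - x| <= s -> `|a - y| <= s ->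
    `|x - y - (f x - f y) *m invmx B| <= 2^-1 * `|x - y|) ->
  `|(f a - w) *m invmx B| <= s / 2 ->
  exists2 x, `|a - x| <= s & f x = w.
Proof.
move=> uB s0 cf fB wa.
pose D := closed_ball_ Num.norm a s.
pose T x := x - (f x - w) *m invmx B.
have TD x : D x -> D (T x).
  move=> Dx; have Da : D a by rewrite /D /closed_ball_/= subrr normr0 ltW.
  rewrite /D /closed_ball_/=.
  have -> : a - T x =
      (a - x - (f a - f x) *m invmx B) + (f a - w) *m invmx B.
    rewrite /T !mulmxBl; move: (f a *m _) (f x *m _) (w *m _) => *.
    by apply/rowP => k; rewrite !mxE; ring.
  apply: le_trans (ler_normD _ _) _; rewrite (splitr s).
  apply: lerD => //; apply: le_trans (fB _ _ Da Dx) _.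
  by rewrite mulrC ler_wpM2r.
have D0 : D !=set0 by exists a; rewrite /D /closed_ball_/= subrr normr0 ltW.
have Dc : compact D.
  apply: bounded_closed_compact; last exact: closed_closed_ball_.
  exists (`|a| + s); split; first exact: num_real.
  move=> M /ltW aM x; rewrite /D /closed_ball_/= => ax; apply: le_trans aM.
  have -> : x = a - (a - x) by rewrite subKr.
  by apply: le_trans (ler_normB _ _) _; rewrite lerD2l.
have phic : {within D, continuous (fun x => `|(f x - w) *m invmx B|)}.
  apply: continuous_in_subspaceT => x; rewrite inE => Dx.
  have c1 : (f z - w) @[z --> x] --> f x - w.
    exact: (@cvgB _ _ _ _ (nbhs_filter x) _ _ _ _ (cf x Dx) (cvg_cst _)).
  apply: (cvg_norm (FF := nbhs_filter x)).
  exact: (cvg_comp _ _ c1 (@mulmxr_continuous _ _ (invmx B) _)).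
have [x /set_mem Dx xmin] := EVT_min_rV D0 Dc phic.
exists x => //; have := xmin (T x) (mem_set (TD x Dx)).
have := fB x (T x) Dx (TD x Dx).
have -> : x - T x = (f x - w) *m invmx B by rewrite /T subKr.
(* The residual at [T x] is the linearization defect between [x] and [T x], hence at most half the
   residual at [x]; minimality forces the latter to vanish. *)
have -> : (f x - w) *m invmx B - (f x - f (T x)) *m invmx B =
    (f (T x) - w) *m invmx B.
  rewrite !mulmxBl; move: (f x *m _) (f (T x) *m _) (w *m _) => *.
  by apply/rowP => k; rewrite !mxE; ring.
move=> le1 le2; have /eqP : `|(f x - w) *m invmx B| = 0.
  by apply/eqP; rewrite eq_le normr_ge0 andbT; lra.
rewrite normr_eq0 => /eqP fx0; apply/eqP; rewrite -subr_eq0; apply/eqP.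
by rewrite -[LHS](mulmxKV uB) fx0 mul0mx.
Qed.

(** Near [a], [f] differs from its linearization by a map of small Lipschitz constant. This gives
    solvability through [newton_solution] and a Lipschitz bound for the inverse, from which its
    Jacobian and the continuity of that Jacobian follow. *)
Theorem inverse_function d V (f : 'rV[R]_d -> 'rV[R]_d) a :
  open_nbhs a V -> C1_on V f -> jacobian f a \in unitmx ->
  exists (U : set 'rV[R]_d) (g : 'rV[R]_d -> 'rV[R]_d),
    [/\ open_nbhs (f a) U, C1_on U g, g (f a) = a &
        forall w, U w -> f (g w) = w].
Proof.
move=> aV fV; set B := jacobian f a => uB.
have [K K0 mulBV] := mulmxr_bounded (invmx B).
have e0 : 0 < (2 * K)^-1 by rewrite invr_gt0 mulr_gt0.
have d0 : 0 < d%:R + 1 :> R by rewrite ltr_wpDl.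
(* The bound [(2 * K)^-1] makes the Newton defect contract by [K / (2 * K) = 1 / 2]; [d%:R + 1]
   absorbs the dimension factor of [norm_mulmx_le]. *)
have [r /= r0 ar] : exists2 r : R, 0 < r & forall z, ball a r z ->
    [/\ V z, jacobian f z \in unitmx &
        `|B - jacobian f z| <= (2 * K)^-1 / (d%:R + 1)].
  have [_ cJ] := fV a aV.2.
  have : \forall z \near a, [/\ V z, jacobian f z \in unitmx &
      `|B - jacobian f z| <= (2 * K)^-1 / (d%:R + 1)].
    have Jcvg (P : set 'M[R]_d) : nbhs B P -> \forall z \near a, P (jacobian f z).
      exact: cJ.
    have uJ := Jcvg _ (near_invmx_bound uB).
    have dJ : \forall z \near a,
        `|B - jacobian f z| <= (2 * K)^-1 / (d%:R + 1).
      apply: (Jcvg [set M | `|B - M| <= (2 * K)^-1 / (d%:R + 1)]).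
      have /cvgrPdist_le := @cvg_id _ (nbhs B); apply.
      exact: divr_gt0.
    apply: filterS3 (open_nbhs_nbhs aV) uJ dJ => z Vz [uz _] dz.
    by split.
  by move=> /nbhs_ballP[r r0 ar]; exists r.
have strict x y : ball a r x -> ball a r y ->
    `|f x - f y - (x - y) *m B| <= (2 * K)^-1 * `|x - y|.
  apply: mean_value_jacobian; first exact: ltW.
  move=> z /ar[Vz _ Bz]; split; first exact: (fV z Vz).1.
  move=> v; apply: le_trans (norm_mulmx_le _ _) _; rewrite ler_wpM2r//.
  rewrite distrC; apply: le_trans (ler_wpM2l (ler0n _ _) Bz) _.
  by rewrite mulrCA ger_pMr// ler_pdivrMr// mul1r lerDl.
have newton x y : ball a r x -> ball a r y ->
    `|x - y - (f x - f y) *m invmx B| <= 2^-1 * `|x - y|.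
  move=> ax ay; rewrite -{1}(mulmxK uB (x - y)) -mulmxBl.
  apply: le_trans (mulBV _) _; rewrite distrC.
  apply: le_trans (ler_wpM2l (ltW K0) (strict x y ax ay)) _.
  by rewrite mulrA invfM mulrCA mulfV ?gt_eqF// mulr1.
have lip x y : ball a r x -> ball a r y -> `|x - y| <= 2 * K * `|f x - f y|.
  move=> ax ay; have := newton x y ax ay; have := mulBV (f x - f y).
  have := ler_normD (x - y - (f x - f y) *m invmx B) ((f x - f y) *m invmx B).
  by rewrite subrK; lra.
have s0 : 0 < r / 2 by rewrite divr_gt0.
have sr x : `|a - x| <= r / 2 -> ball a r x.
  by rewrite -ball_normE/= => ax; lra.
(* For [w] in [U], [|(f a - w) B^-1| <= r / 4], the bound that [newton_solution] requires for
   [s = r / 2]; that closed ball lies in [ball a r]. *)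
pose U := ball (f a) (r / 2 / (2 * K)).
have aU : open_nbhs (f a) U.
  by split; [exact: ball_open|apply: ballxx; rewrite divr_gt0// mulr_gt0].
(* The default [a] is taken only where no preimage exists, hence never on [U]. *)
pose g w := xget a [set x | `|a - x| <= r / 2 /\ f x = w].
have gP w : U w -> `|a - g w| <= r / 2 /\ f (g w) = w.
  move=> Uw; apply: (@xgetPex _ a [set x | `|a - x| <= r / 2 /\ f x = w]).
  suff [x ax fx] : exists2 x, `|a - x| <= r / 2 & f x = w by exists x.
  apply: (newton_solution uB s0) => [x /sr/ar[Vx _ _]|x y /sr ax /sr ay|].
  - exact/differentiable_continuous/(fV x Vx).1.
  - exact: newton.
  - apply: le_trans (mulBV _) _; move: Uw; rewrite /U -ball_normE/=.
    by rewrite ltr_pdivlMr ?mulr_gt0// => ?; lra.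
have gK w : U w -> f (g w) = w by move=> /gP[].
have gball w : U w -> ball a r (g w) by move=> /gP[/sr].
have dg w : U w ->
    differentiable g w /\ jacobian g w = invmx (jacobian f (g w)).
  move=> Uw; apply/differentiable_jacobianP => e epos.
  have [Vx uA _] := ar _ (gball w Uw).
  set A := jacobian f (g w) in uA *.
  have [L L0 mulAV] := mulmxr_bounded (invmx A).
  have KL : 0 < 2 * K * L by apply: mulr_gt0 => //; exact: mulr_gt0.
  (* The defect of [g] is at most [L] times that of [f], which is at most [e / (2 * K * L)] times
     [|g w' - g w| <= 2 * K * |w' - w|]; the product is [e * |w' - w|]. *)
  have c0 : 0 < e / (2 * K * L) by exact: divr_gt0.
  have /nbhs_ballP[p /= p0 fp] :=
    (differentiable_jacobianP _ _ _).1 (conj (fV _ Vx).1 erefl) _ c0.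
  have pK : 0 < p / (2 * K) by rewrite divr_gt0// mulr_gt0.
  have Un : nbhs w U by apply: open_nbhs_nbhs; split => //; exact: aU.1.
  apply: filterS2 Un (nbhsx_ballx w _ pK) => w' Uw' ww'.
  have gg : `|g w' - g w| <= 2 * K * `|w' - w|.
    by have := lip _ _ (gball _ Uw') (gball _ Uw); rewrite !gK.
  have := fp (g w'); rewrite -ball_normE/= => /(_ _)/wrap[].
    rewrite distrC; apply: le_lt_trans gg _.
    move: ww'; rewrite -ball_normE/= distrC ltr_pdivlMr ?mulr_gt0//.
    by rewrite mulrC.
  rewrite !gK// -/A => fg.
  rewrite -{1}(mulmxK uA (g w' - g w)) -mulmxBl.
  apply: le_trans (mulAV _) _; rewrite distrC.
  apply: le_trans (ler_wpM2l (ltW L0) fg) _.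
  apply: le_trans (ler_wpM2l (ltW L0) (ler_wpM2l (ltW c0) gg)) _.
  rewrite le_eqVlt; apply/orP; left; apply/eqP; field.
  by rewrite !gt_eqF.
exists U, g; split; [exact: aU| | |exact: gK].
  move=> w Uw; have [dgw Jg] := dg w Uw; split; first exact: dgw.
  have [Vx uA _] := ar _ (gball w Uw).
  suff : jacobian g z @[z --> w] --> jacobian g w by [].
  have cg : g z @[z --> w] --> g w by exact: differentiable_continuous.
  have c1 := cvg_comp _ _ (cvg_comp _ _ cg (fV _ Vx).2) (invmx_continuous uA).
  rewrite Jg; apply: cvg_trans c1.
  apply: (near_eq_cvg (FF := nbhs_filter w)).
  have Un : nbhs w U by apply: open_nbhs_nbhs; split => //; exact: aU.1.
  by apply: filterS Un => z /dg[_ Jz]; exact: esym Jz.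
have Ua : U (f a) by exact: aU.2.
(* [g (f a)] and [a] lie in the same ball and have the same image, so [lip] identifies them. *)
have := lip _ _ (gball _ Ua) (ballxx a r0).
by rewrite gK// subrr normr0 mulr0 normr_le0 subr_eq0 => /eqP.
Qed.

(** * Nonsingularity and local inverses from the P_0 property *)

(* A kernel vector [v] of [jacobian P x + c%:M] satisfies [D_v P = - c v], so for
   small [h > 0] every coordinate with [v_i != 0] gives
   [h v_i (P (x + h v) - P x)_i < 0], against [P0_map]. *)
Lemma P0_jacobian_unitmx d (P : 'rV[R]_d -> 'rV[R]_d) x (c : R) :
  P0_map P -> differentiable P x -> 0 < c -> jacobian P x + c%:M \in unitmx.
Proof.
move=> P0 dP c0; apply/negPn/negP; rewrite unitmxE unitfE negbK.
move=> /det0P[v v0]; rewrite mulmxDr mul_mx_scalar => /eqP.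
rewrite addr_eq0 => /eqP vJ.
have nv : 0 < `|v| by rewrite normr_gt0.
(* At [y = x + h *: v] this tolerance equals [h c |v_i| / 2], half the size of the main term
   [- h c v_i], so the sign survives. *)
pose A i y := v 0 i != 0 -> `|P y - P x - (y - x) *m jacobian P x| <=
  c * `|v 0 i| / (2 * `|v|) * `|y - x|.
have : \forall y \near x, forall i, A i y.
  apply: (@filter_forall _ _ A (nbhs x) (nbhs_filter x)) => i.
  have [vi0|vi0] := eqVneq (v 0 i) 0.
    by apply: nearW => y; rewrite /A vi0 eqxx.
  have e0 : 0 < c * `|v 0 i| / (2 * `|v|).
    by apply: divr_gt0; apply: mulr_gt0 => //; rewrite normr_gt0.
  have := (differentiable_jacobianP _ _ _).1 (conj dP erefl) _ e0.
  by apply: filterS => y Py _.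
move=> /nbhs_ballP[p /= p0 xp].
pose h := p / (2 * `|v|).
have h0 : 0 < h by rewrite divr_gt0// mulr_gt0.
have nhv : `|h *: v| = p / 2.
  by rewrite normrZ gtr0_norm// /h; field; rewrite gt_eqF.
have hx : x + h *: v <> x.
  move=> /(canRL (addKr x))/eqP; rewrite addNr scaler_eq0 (negPf v0) orbF.
  by rewrite gt_eqF.
have xhv : ball x p (x + h *: v).
  by rewrite -ball_normE/= opprD addrA subrr add0r normrN nhv; lra.
have := P0 _ _ hx; rewrite leNgt => /negP; apply.
(* The unit [-oo] is itself below 0, so it remains to make each indexed term negative. *)
apply/bigmax_ltP; split => // i; rewrite !mxE.
rewrite (addrC (x 0 i)) addrK -subr_eq0 addrK mulf_eq0 negb_or => /andP[_ vi0].
have := xp _ xhv i vi0.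
rewrite (addrC x) addrK -scalemxAl vJ normrZ gtr0_norm//.
have -> : c * `|v 0 i| / (2 * `|v|) * (h * `|v|) = h * c * `|v 0 i| / 2.
  by field; rewrite gt_eqF.
move=> /(le_trans (mx_entry_le_norm _ 0 i)); rewrite !mxE.
set q := P _ 0 i - P x 0 i => qh; rewrite lte_fin -mulrA pmulr_rlt0//.
have v2 : 0 < `|v 0 i| by rewrite normr_gt0.
(* Multiplying by [|v_i|] gives [v_i q <= - h c v_i^2 + h c v_i^2 / 2 < 0]. *)
have := ler_wpM2l (ltW v2) qh; rewrite -normrM ler_norml => /andP[_].
have := mulr_gt0 (mulr_gt0 h0 c0) (mulr_gt0 v2 v2).
have vv : `|v 0 i| * `|v 0 i| = v 0 i * v 0 i.
  by rewrite -normrM ger0_norm// -expr2 sqr_ge0.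
have -> : `|v 0 i| * (h * c * `|v 0 i| / 2) = h * c * (v 0 i * v 0 i) / 2.
  by rewrite -vv; field.
rewrite vv; lra.
Qed.

(** The Jacobian is [a] times that of [P] plus [2 I], hence invertible. Either sign of [a] is
    allowed: part (i) takes [a = 1/2], part (ii) [a = -1/2]. *)
Lemma P0_local_inverse d V (P : 'rV[R]_d -> 'rV[R]_d) x (a : R) :
  P0_map P -> open_nbhs x V -> C1_on V P -> a != 0 ->
  let f := fun y => a *: P y + (a * 2) *: y in
  exists (U : set 'rV[R]_d) (g : 'rV[R]_d -> 'rV[R]_d),
    [/\ open_nbhs (f x) U, C1_on U g, g (f x) = x &
        forall w, U w -> f (g w) = w].
Proof.
move=> P0 xV PV a0 f; apply: (inverse_function xV).
  by apply: C1_on_scale_add_id => //; exact: xV.1.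
have dP := (PV x xV.2).1.
have -> : f = (fun y => a *: P y + y *m (a * 2)%:M).
  by apply/funext => y; rewrite mul_mx_scalar.
have [_ ->] := jacobian_scale_add_mx a (a * 2)%:M dP.
rewrite -scale_scalar_mx -scalerDr unitmxZ ?unitfE//.
exact: P0_jacobian_unitmx.
Qed.

(** * The two complementarity problems *)

Lemma posv_negv_complementary d (x : 'rV[R]_d) :
  complementary (posv x) (negv x).
Proof.
split=> j; rewrite !mxE ?le_max ?lexx ?orbT//.
by case: (lerP (x 0 j) 0) => xj; case: lerP => ?; rewrite ?mul0r ?mulr0//; lra.
Qed.

End inverse_function.

Theorem lemma2p5 (R : realType) (d : nat) (F : 'rV[R]_d -> 'rV[R]_d)
    (xs ys zs : 'rV[R]_d)
    (Fxs : F xs = absv xs) (ysE : ys = posv xs) (zsE : zs = negv xs)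
    (FC1 : exists V : set 'rV[R]_d, open_nbhs xs V /\ C1_on V F) :
  [/\ xs = ys - zs /\ F (ys - zs) - (ys + zs) = 0,
      P0_map (fun x => F x - x) ->
      exists (U : set 'rV[R]_d) (H : 'rV[R]_d -> 'rV[R]_d),
        [/\ open_nbhs ys U,
            C1_on U H,
            forall y, U y -> H y = F (y - H y) - y,
            zs = H ys &
            H ys = F (ys - H ys) - ys /\ complementary ys (H ys)] &
      P0_map (fun x => - (F x + x)) ->
      exists (W : set 'rV[R]_d) (Ht : 'rV[R]_d -> 'rV[R]_d),
        [/\ open_nbhs zs W,
            C1_on W Ht,
            forall z, W z -> Ht z = F (Ht z - z) - z,
            ys = Ht zs &
            Ht zs = F (Ht zs - zs) - zs /\ complementary zs (Ht zs)]].
Proof.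
have xE : xs = ys - zs.
  apply/rowP => j; rewrite ysE zsE !mxE.
  by case: (lerP (xs 0 j) 0) => ?; case: lerP => ?; lra.
have FE : F xs = ys + zs.
  rewrite Fxs ysE zsE; apply/rowP => j; rewrite !mxE.
  by case: (lerP (xs 0 j) 0) => ?; case: lerP => ?; case: ger0P => ?; lra.
have yz : complementary ys zs by rewrite ysE zsE; exact: posv_negv_complementary.
have zy : complementary zs ys by case: yz => ? ? yz0; split=> // j; rewrite mulrC.
have h2 : (2^-1 : R) != 0 by [].
have [V [xV FV]] := FC1.
split.
- by split=> //; rewrite -xE FE subrr.
- move=> P0.
  have PV : C1_on V (fun x => F x - x).
    have := C1_on_scale_add_id 1 (-1) xV.1 FV.
    by under eq_fun do rewrite scale1r scaleN1r.
  have [U [g []]] := P0_local_inverse P0 xV PV h2.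
  have -> : 2^-1 *: (F xs - xs) + (2^-1 * 2) *: xs = ys.
    by rewrite FE xE; apply/rowP => j; rewrite !mxE; field.
  move=> Uy gU gy fg.
  pose H y := y - g y.
  (* At [x = g y], [(F x + x) / 2 = y] gives [F x - y = y - x = H y], and [y - H y = x]. *)
  have HE y : U y -> H y = F (y - H y) - y.
    move=> /fg /rowP gE; rewrite /H subKr; apply/rowP => j.
    by have := gE j; rewrite !mxE; lra.
  have Hy : H ys = zs by rewrite /H gy xE subKr.
  exists U, H; split; [exact: Uy| |exact: HE|exact: esym Hy|].
  + have := C1_on_scale_add_id (-1) 1 Uy.1 gU.
    by under eq_fun do rewrite scale1r scaleN1r addrC.
  + by split; [exact: HE Uy.2|rewrite Hy].
- move=> P0.
  have PV : C1_on V (fun x => - (F x + x)).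
    have := C1_on_scale_add_id (-1) (-1) xV.1 FV.
    by under eq_fun do rewrite !scaleN1r -opprD.
  have h2N : (- 2^-1 : R) != 0 by rewrite oppr_eq0.
  have [U [g []]] := P0_local_inverse P0 xV PV h2N.
  have -> : - 2^-1 *: - (F xs + xs) + (- 2^-1 * 2) *: xs = zs.
    by rewrite FE xE; apply/rowP => j; rewrite !mxE; field.
  move=> Uz gU gz fg.
  pose H z := z + g z.
  (* At [x = g z], [(F x - x) / 2 = z] gives [F x - z = z + x = H z], and [H z - z = x]. *)
  have HE z : U z -> H z = F (H z - z) - z.
    move=> /fg /rowP gE; rewrite /H (addrC z) addrK; apply/rowP => j.
    by have := gE j; rewrite !mxE; lra.
  have Hz : H zs = ys by rewrite /H gz xE addrC subrK.
  exists U, H; split; [exact: Uz| |exact: HE|exact: esym Hz|].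
  + have := C1_on_scale_add_id 1 1 Uz.1 gU.
    by under eq_fun do rewrite !scale1r addrC.
  + by split; [exact: HE Uz.2|rewrite Hz].
Qed.
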